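(* Let $G$ be a connected graph with maximum degree $\Delta$ and minimum degree $\delta$. Then $$\sqrt{2}\,H(G)\leq BSO(G)\leq \frac{1}{\sqrt{2}}\left(\frac{\Delta}{\delta}+\frac{\delta}{\Delta}\right)H(G),$$ with equality (in either inequality) if and only if $G$ is a regular graph.
   Context: Graphs are finite, simple and undirected. For a connected graph $G$ with edge set $E(G)$, $d_v$ denotes the degree of the vertex $v$ in $G$. The first Banhatti-Sombor index is $BSO(G)=\sum_{uv\in E(G)}\sqrt{\frac{1}{d_u^2}+\frac{1}{d_v^2}}$ and the harmonic index is $H(G)=\sum_{uv\in E(G)}\frac{2}{d_u+d_v}$. *)

(* Defs.v *)
From mathcomp Require Import all_boot all_order all_algebra.

Set Implicit Arguments.
Unset Strict Implicit.
Unset Printing Implicit Defensive.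

Import Order.TTheory GRing.Theory Num.Theory.
Local Open Scope ring_scope.

(* A finite simple graph on the vertex type T is a symmetric irreflexive
   adjacency relation e : rel T. *)

Definition deg (T : finType) (e : rel T) (v : T) : nat := #|[set w | e v w]|.

Definition max_deg (T : finType) (e : rel T) : nat := (\max_(v : T) deg e v)%N.

(* The default #|T| bounds every degree, so for nonempty T this is the least
   degree. *)
Definition min_deg (T : finType) (e : rel T) : nat :=
  \big[minn/#|T|]_(v : T) deg e v.

Definition connected_graph (T : finType) (e : rel T) : Prop :=
  (0 < #|T|)%N /\ forall u v : T, connect e u v.

Definition regular_graph (T : finType) (e : rel T) : Prop :=
  exists k : nat, forall v : T, deg e v = k.

(* Each undirected edge uv is the two-element set [set u; v], hence counted
   once. *)
Definition edges (T : finType) (e : rel T) : {set {set T}} :=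
  [set [set p.1; p.2] | p : T * T & e p.1 p.2].

(* For an edge A = [set u; v] (u != v), a sum over w in A has exactly the two
   terms for w = u and w = v. *)
Definition BSO (R : rcfType) (T : finType) (e : rel T) : R :=
  \sum_(A in edges e) Num.sqrt (\sum_(w in A) 1 / (deg e w)%:R ^+ 2).

Definition harmonic (R : rcfType) (T : finType) (e : rel T) : R :=
  \sum_(A in edges e) 2 / (\sum_(w in A) (deg e w)%:R).

(* Main.v *)
Require Import Defs.
From mathcomp Require Import all_boot all_order all_algebra.
From mathcomp Require Import ring.

Set Implicit Arguments.
Unset Strict Implicit.
Unset Printing Implicit Defensive.

Import Order.TTheory GRing.Theory Num.Theory.
Local Open Scope ring_scope.

(** Both inequalities hold edge by edge.  Let an edge have end degrees [a] and
    [b], and put [s = a^2 + b^2], [p = a b].  The edge contributes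
    [sqrt s / p] to the Banhatti-Sombor index and [2 / (a + b)] to the harmonic
    index.  After squaring,
    - the lower bound is [8 p^2 <= s (a + b)^2], and the difference of the two
      sides is [(a - b)^2 (s + 4 p)];
    - the bound [sqrt s / p <= (1 / sqrt 2) (a / b + b / a) (2 / (a + b))] is
      [(a + b)^2 <= 2 s], and the difference is [(a - b)^2].

    The ratio sum [a / b + b / a] is at most [D / d + d / D] as soon as [a] and
    [b] lie between [d] and [D], because
    [a b (D^2 + d^2) - D d (a^2 + b^2) = (D a - d b) (D b - d a)].
    When [a = b], equality here amounts to [D = d].

    Recording the equality cases with [_ <= _ ?= iff _] lets them be summed over
    the edges: equality of the sums means equality on every edge.  The lower
    bound is therefore attained exactly when adjacent vertices have the same
    degree, and by connectedness this means that the graph is regular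
    ([regular_graphP]).  The upper bound moreover asks, on every edge, that the
    extreme degrees coincide, which regularity implies
    ([max_deg_eq_min_deg]). *)

(** * Inequalities for the contribution of one edge *)

Section EdgeTerm.
Variable R : rcfType.
Implicit Types a b d D x y : R.

Lemma leif_of_sqr x y (c : bool) : 0 <= x -> 0 <= y ->
  x ^+ 2 <= y ^+ 2 ?= iff c -> x <= y ?= iff c.
Proof.
move=> x0 y0 [lexy eqxy]; split; first by rewrite -ler_sqr.
by rewrite -eqxy eqrXn2.
Qed.

Lemma leif_of_subr x y (c : bool) : 0 <= y - x -> (y - x == 0) = c ->
  x <= y ?= iff c.
Proof.
by move=> xy <-; split; [rewrite -subr_ge0 | rewrite subr_eq0 eq_sym].
Qed.

Lemma sqrt2_harmonic_term_leif a b : 0 < a -> 0 < b ->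
  Num.sqrt 2 * (2 / (a + b)) <= Num.sqrt (1 / a ^+ 2 + 1 / b ^+ 2)
    ?= iff (a == b).
Proof.
move=> a0 b0; have ab0 : 0 < a + b by rewrite addr_gt0.
have aN0 : a != 0 by rewrite gt_eqF.
have bN0 : b != 0 by rewrite gt_eqF.
have abN0 : a + b != 0 by rewrite gt_eqF.
have k0 : 0 < (a ^+ 2 + b ^+ 2 + 4 * (a * b)) / ((a + b) * (a * b)) ^+ 2.
  by rewrite divr_gt0 ?exprn_gt0 ?mulr_gt0 // !addr_gt0 ?exprn_gt0 ?mulr_gt0.
apply: leif_of_sqr; [|exact: sqrtr_ge0|].
  by rewrite mulr_ge0 ?sqrtr_ge0 ?divr_ge0 ?ltW.
rewrite exprMn !sqr_sqrtr ?ler0n //; last first.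
  by rewrite addr_ge0 ?divr_ge0 ?sqr_ge0.
have diffE : 1 / a ^+ 2 + 1 / b ^+ 2 - 2 * (2 / (a + b)) ^+ 2 =
    (a - b) ^+ 2 *
    ((a ^+ 2 + b ^+ 2 + 4 * (a * b)) / ((a + b) * (a * b)) ^+ 2).
  by field; rewrite aN0 bN0 abN0.
apply: leif_of_subr; rewrite diffE; first by rewrite mulr_ge0 ?sqr_ge0 ?ltW.
by rewrite mulf_eq0 (gt_eqF k0) orbF sqrf_eq0 subr_eq0.
Qed.

Lemma bso_term_leif a b : 0 < a -> 0 < b ->
  Num.sqrt (1 / a ^+ 2 + 1 / b ^+ 2) <=
    1 / Num.sqrt 2 * (a / b + b / a) * (2 / (a + b)) ?= iff (a == b).
Proof.
move=> a0 b0; have ab0 : 0 < a + b by rewrite addr_gt0.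
have aN0 : a != 0 by rewrite gt_eqF.
have bN0 : b != 0 by rewrite gt_eqF.
have abN0 : a + b != 0 by rewrite gt_eqF.
have k0 : 0 < (a ^+ 2 + b ^+ 2) / ((a + b) * (a * b)) ^+ 2.
  by rewrite divr_gt0 ?exprn_gt0 ?mulr_gt0 // !addr_gt0 ?exprn_gt0.
apply: leif_of_sqr; first by rewrite sqrtr_ge0.
  by rewrite !mulr_ge0 ?invr_ge0 ?sqrtr_ge0 ?addr_ge0 ?divr_ge0 ?ltW.
rewrite !exprMn exprVn !sqr_sqrtr ?ler0n //; last first.
  by rewrite addr_ge0 ?divr_ge0 ?sqr_ge0.
have diffE : 1 ^+ 2 * 2^-1 * (a / b + b / a) ^+ 2 * (2 ^+ 2 * (a + b)^-1 ^+ 2)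
    - (1 / a ^+ 2 + 1 / b ^+ 2) =
    (a - b) ^+ 2 * ((a ^+ 2 + b ^+ 2) / ((a + b) * (a * b)) ^+ 2).
  by field; rewrite aN0 bN0 abN0.
apply: leif_of_subr; rewrite diffE; first by rewrite mulr_ge0 ?sqr_ge0 ?ltW.
by rewrite mulf_eq0 (gt_eqF k0) orbF sqrf_eq0 subr_eq0.
Qed.

Lemma ratio_sum_leif a b d D : 0 < d -> d <= a <= D -> d <= b <= D ->
  a / b + b / a <= D / d + d / D ?= iff ((D * a == d * b) || (D * b == d * a)).
Proof.
move=> d0 /andP[da aD] /andP[db bD].
have a0 : 0 < a := lt_le_trans d0 da.
have b0 : 0 < b := lt_le_trans d0 db.
have D0 : 0 < D := lt_le_trans a0 aD.
have k0 : 0 < (a * b * (d * D))^-1 by rewrite invr_gt0 !mulr_gt0.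
have cross x y : d <= x -> 0 < y <= D -> 0 <= D * x - d * y.
  by move=> dx /andP[y0 yD]; rewrite subr_ge0 [D * x]mulrC ler_pM // ltW.
have diffE : D / d + d / D - (a / b + b / a) =
    (D * a - d * b) * (D * b - d * a) * (a * b * (d * D))^-1.
  by field; rewrite !gt_eqF.
apply: leif_of_subr; rewrite diffE.
  by rewrite mulr_ge0 ?(ltW k0) // mulr_ge0 // cross ?a0 ?b0.
by rewrite mulf_eq0 (gt_eqF k0) orbF mulf_eq0 !subr_eq0.
Qed.

(** The first of the two chained bounds is tight when [a = b]; for such ends
    the tightness condition of [ratio_sum_leif] reduces to [D a = d a]. *)
Lemma bso_term_leif_extremes a b d D : 0 < d -> d <= a <= D -> d <= b <= D ->
  Num.sqrt (1 / a ^+ 2 + 1 / b ^+ 2) <=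
    1 / Num.sqrt 2 * (D / d + d / D) * (2 / (a + b))
    ?= iff ((a == b) && (D == d)).
Proof.
move=> d0 daD dbD.
have a0 : 0 < a by apply: lt_le_trans d0 _; case/andP: daD.
have b0 : 0 < b by apply: lt_le_trans d0 _; case/andP: dbD.
have s2 : 0 < 1 / Num.sqrt 2 :> R by rewrite divr_gt0 ?sqrtr_gt0.
have h0 : 0 < 2 / (a + b) by rewrite divr_gt0 ?addr_gt0.
have [le2 eq2] := ratio_sum_leif d0 daD dbD.
have le3 : 1 / Num.sqrt 2 * (a / b + b / a) * (2 / (a + b)) <=
    1 / Num.sqrt 2 * (D / d + d / D) * (2 / (a + b))
    ?= iff ((D * a == d * b) || (D * b == d * a)).
  split; first by rewrite ler_pM2r // ler_pM2l.
  by rewrite (inj_eq (mulIf (lt0r_neq0 h0))) (inj_eq (mulfI (lt0r_neq0 s2))).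
have [le4 eq4] := leif_trans (bso_term_leif a0 b0) le3.
split=> //; rewrite eq4; case: eqP => //= <-.
by rewrite orbb (inj_eq (mulIf (lt0r_neq0 a0))).
Qed.

End EdgeTerm.

(** * Degrees in a connected graph *)

Section Graph.
Variables (T : finType) (e : rel T).
Implicit Types u v w : T.

Lemma deg_le_max_deg v : (deg e v <= max_deg e)%N.
Proof. exact: leq_bigmax. Qed.

Lemma min_deg_le_deg v : (min_deg e <= deg e v)%N.
Proof. by rewrite /min_deg -minEnat -leEnat; apply: bigmin_le. Qed.

Lemma leq_min_deg k : (0 < #|T|)%N -> (forall v, k <= deg e v)%N ->
  (k <= min_deg e)%N.
Proof.
move=> /card_gt0P[v _] lek; apply: (big_ind (fun m => k <= m)%N) => //.
- exact: leq_trans (lek v) (max_card _).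
- by move=> x y kx ky; rewrite leq_min kx.
Qed.

Lemma max_deg_eq_min_deg : (0 < #|T|)%N -> regular_graph e ->
  max_deg e = min_deg e.
Proof.
move=> T0 [k degk]; apply/eqP; rewrite eqn_leq; apply/andP; split.
  apply: leq_min_deg => // v; apply/bigmax_leqP => w _.
  by rewrite !degk.
have /card_gt0P[v _] := T0.
exact: leq_trans (min_deg_le_deg v) (deg_le_max_deg v).
Qed.

(** In a connected graph a vertex is isolated only if it is the single
    vertex: the path to any other vertex starts with an edge. *)
Lemma deg_gt0 u v w : connected_graph e -> v != w -> (0 < deg e u)%N.
Proof.
move=> [_ conn] vw.
have [x ux] : exists x, u != x.
  have [uv|uv] := eqVneq u v; last by exists v.
  by exists w; rewrite uv.
have /connectP[[|y p] /= ep xE] := conn u x.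
  by rewrite xE eqxx in ux.
by case/andP: ep => uy _; apply/card_gt0P; exists y; rewrite inE.
Qed.

Lemma regular_graphP : connected_graph e ->
  regular_graph e <-> (forall u v, e u v -> deg e u = deg e v).
Proof.
move=> [/card_gt0P[r _] conn]; split=> [[k degk] u v _|eq_deg].
  by rewrite !degk.
exists (deg e r) => v; have /connectP[p ep ->] := conn r v.
elim: p r ep {conn} => //= x p IHp r /andP[rx /IHp ->].
by rewrite (eq_deg r x).
Qed.

(** A form of the equality of the two end degrees that depends only on the
    edge as a set, as sums over [edges e] require. *)
Definition balanced (A : {set T}) : bool :=
  [forall u in A, forall v in A, deg e u == deg e v].

Lemma balanced2 u v : balanced [set u; v] = (deg e u == deg e v).
Proof.
apply/idP/eqP => [/forall_inP/(_ u)|uv].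
  by rewrite set21 => /(_ isT)/forall_inP/(_ v); rewrite set22 => /(_ isT)/eqP.
apply/forall_inP => x; rewrite !inE => xuv; apply/forall_inP => y.
by rewrite !inE => yuv; case/orP: xuv => /eqP->; case/orP: yuv => /eqP->;
  rewrite ?uv.
Qed.

Lemma regular_graph_balanced : connected_graph e ->
  regular_graph e <-> [forall A in edges e, balanced A].
Proof.
move=> conn; split.
  move=> /(regular_graphP conn) eq_deg.
  apply/forall_inP => A /imsetP[[u v]]; rewrite inE => /= uv ->.
  by rewrite balanced2 (eq_deg _ _ uv).
move=> /forall_inP bal; apply/(regular_graphP conn) => u v uv.
apply/eqP; rewrite -balanced2; apply: bal.
by apply/imsetP; exists (u, v); rewrite ?inE.
Qed.

End Graph.

(** * The bounds *)

Theorem theorem3p10 (R : rcfType) (T : finType) (e : rel T)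
    (e_sym : symmetric e) (e_irr : irreflexive e)
    (e_conn : connected_graph e) :
  let Delta : R := (max_deg e)%:R in
  let delta : R := (min_deg e)%:R in
  let C : R := 1 / Num.sqrt 2 * (Delta / delta + delta / Delta) in
  [/\ Num.sqrt 2 * harmonic R e <= BSO R e,
      BSO R e <= C * harmonic R e,
      Num.sqrt 2 * harmonic R e = BSO R e <-> regular_graph e
    & BSO R e = C * harmonic R e <-> regular_graph e].
Proof.
move=> Delta delta C.
have T0 : (0 < #|T|)%N by case: e_conn.
(* Irreflexivity makes the two ends distinct, so that neither term of a sum
   over the edge is lost. *)
have edge_ends A : A \in edges e -> exists u v, [/\ u != v, A = [set u; v] &
    forall F : T -> R, \sum_(w in A) F w = F u + F v].
  move=> /imsetP[[u v]]; rewrite inE /= => uv ->; exists u, v.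
  have neq_uv : u != v by apply: contraTneq uv => ->; rewrite e_irr.
  by split=> // F; rewrite big_setU1 ?inE //= big_set1.
have lower : Num.sqrt 2 * harmonic R e <= BSO R e
    ?= iff [forall A in edges e, balanced e A].
  rewrite /harmonic mulr_sumr; apply: leif_sum => A /edge_ends.
  case=> u [v [uv -> sumE]]; rewrite !sumE balanced2 -(eqr_nat R).
  by apply: sqrt2_harmonic_term_leif; rewrite ltr0n (deg_gt0 _ e_conn uv).
have upper : BSO R e <= C * harmonic R e
    ?= iff [forall A in edges e, balanced e A && (Delta == delta)].
  rewrite /harmonic mulr_sumr; apply: leif_sum => A /edge_ends.
  case=> u [v [uv -> sumE]]; rewrite !sumE balanced2 -(eqr_nat R).
  apply: bso_term_leif_extremes.
  - by rewrite ltr0n leq_min_deg // => w; apply: deg_gt0 e_conn uv.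
  - by rewrite !ler_nat min_deg_le_deg deg_le_max_deg.
  - by rewrite !ler_nat min_deg_le_deg deg_le_max_deg.
have [le1 eq1] := lower; have [le2 eq2] := upper.
split=> //.
  apply: iff_trans (iff_sym (regular_graph_balanced e_conn)).
  by rewrite -eq1; split=> /eqP.
split=> [/eqP|reg].
  rewrite eq2 => /forall_inP bal; apply/(regular_graph_balanced e_conn).
  by apply/forall_inP => A /bal/andP[].
apply/eqP; rewrite eq2; apply/forall_inP => A eA.
rewrite /Delta /delta max_deg_eq_min_deg // eqxx andbT.
by move/(regular_graph_balanced e_conn)/forall_inP: reg; apply.
Qed.
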